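(* Let $E$ be a countably Dedekind complete Riesz space and let $(E,\mathbb T)$ with $\mathbb T=\{T_\sigma:\sigma\in\Sigma\}$ be a regular abstract dynamic program. Suppose $(E,\mathbb T)$ is affine, i.e. for each $\sigma\in\Sigma$ there are $r_\sigma\in E$ and an order continuous linear operator $K_\sigma:E\to E$ with $T_\sigma v=r_\sigma+K_\sigma v$ for all $v\in E$. Suppose also that there exist $e\in E$ and $\rho\in[0,1)$ with $|r_\sigma|\le e$ and $K_\sigma e\le\rho e$ for all $\sigma\in\Sigma$. Let $V:=[-e/(1-\rho),\,e/(1-\rho)]\subset E$. Then (i) $(V,\mathbb T)$ (each $T_\sigma$ being restricted to $V$) is also an abstract dynamic program, (ii) the fundamental optimality properties hold for $(V,\mathbb T)$, and (iii) VFI, OPI and HPI all converge in $(V,\mathbb T)$.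
   Context: For elements $v\le w$ of a poset, $[v,w]=\{u:v\le u\le w\}$ is an order interval. A Riesz space $E$ is countably Dedekind complete if, in every order interval, every countable chain has a supremum and an infimum in that interval. Write $v_n\uparrow v$ if $(v_n)$ is increasing with supremum $v$. A self-map $K$ on $E$ is order continuous if $v_n\uparrow v$ in $E$ implies $Kv_n\uparrow Kv$. Abstract dynamic programs. An abstract dynamic program (ADP) is a pair $(V,\mathbb T)$ where $V=(V,\preceq)$ is a poset and $\mathbb T=\{T_\sigma:\sigma\in\Sigma\}$ is a nonempty family of order preserving self-maps on $V$; elements of $\Sigma$ are called policies. (For subsets of $E$ the order is the one inherited from $E$.) Given $v\in V$, $\sigma\in\Sigma$ is $v$-greedy if $T_\tau v\preceq T_\sigma v$ for all $\tau\in\Sigma$. The Bellman operator is $Tv:=\bigvee_\sigma T_\sigma v$ whenever the supremum exists; $v\in V$ solves the Bellman equation if $Tv$ exists and $Tv=v$. $(V,\mathbb T)$ is well-posed if each $T_\sigma$ has a unique fixed point $v_\sigma$ in $V$, and regular if a $v$-greedy policy exists for every $v\in V$. When $(V,\mathbb T)$ is well-posed, $V_\Sigma:=\{v_\sigma:\sigma\in\Sigma\}$; $\sigma$ is optimal if $v_\sigma$ is a greatest element of $V_\Sigma$; and the value function is $v^*:=\bigvee V_\Sigma$ whenever the supremum exists. Bellman's principle of optimality holds if $(V,\mathbb T)$ is well-posed and $\{\sigma\in\Sigma:\sigma\text{ is optimal}\}=\{\sigma\in\Sigma:\sigma\text{ is }v^*\text{-greedy}\}$ (both sets understood as empty if $v^*$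 does not exist). The fundamental optimality properties hold if $(V,\mathbb T)$ is well-posed and regular and: (B1) at least one optimal policy exists; (B2) $v^*$ is the unique solution to the Bellman equation in $V$; (B3) Bellman's principle of optimality holds. Algorithms. Fix, for each $v\in V$, a choice of $v$-greedy policy $\sigma$. Set $Hv:=v_\sigma$ (Howard policy operator) and, for $m\in\mathbb N$, $m\ge1$, $W_mv:=T_\sigma^m v$ (optimistic policy operator), where $\sigma$ is the chosen $v$-greedy policy. Let $V_U=\{v\in V:v\preceq Tv\}$. VFI converges if $T^nv\uparrow v^*$ for all $v\in V_U$; OPI converges if $W_m^nv\uparrow v^*$ for all $v\in V_U$ (for each $m$); HPI converges if $H^nv\uparrow v^*$ for all $v\in V_U$. *)

(* Defs.v *)
From HB Require Import structures.
From mathcomp Require Import all_boot all_order all_algebra.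
From mathcomp Require Import boolp classical_sets functions cardinality.
From mathcomp Require Import set_interval reals.

Set Implicit Arguments.
Unset Strict Implicit.
Unset Printing Implicit Defensive.

Import Order.TTheory GRing.Theory Num.Theory.

Local Open Scope classical_set_scope.
Local Open Scope ring_scope.

(* Order.Lattice has no join with GRing.Zmodule in the algebraic hierarchy, so
   the lattice operations are part of the mixin. *)
HB.mixin Record POrderedLmodule_isRiesz (R : realType) E
    of Num.POrderedZmodule E & GRing.Lmodule R E := {
  riesz_lerD2r : forall z x y : E, x <= y -> x + z <= y + z ;
  riesz_scaler_ge0 : forall (a : R) (x : E), 0 <= a -> 0 <= x -> 0 <= a *: x ;
  riesz_join : E -> E -> E ;
  riesz_meet : E -> E -> E ;
  riesz_leUx : forall x y z : E,
    (riesz_join x y <= z) = (x <= z) && (y <= z) ;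
  riesz_lexI : forall x y z : E,
    (z <= riesz_meet x y) = (z <= x) && (z <= y)
}.

#[short(type="rieszType")]
HB.structure Definition Riesz (R : realType) :=
  { E of Num.POrderedZmodule E & GRing.Lmodule R E
       & POrderedLmodule_isRiesz R E }.

Definition riesz_abs (R : realType) (E : rieszType R) (x : E) : E :=
  riesz_join x (- x).

(* A poset is represented by a set V of elements of a porderType, with the
   inherited order; suprema and infima are taken in V, which in general differs
   from taking them in the ambient type (already for the empty set). *)
Definition sup_in d (P : porderType d) (V A : set P) : set P :=
  [set s | V s /\ ubound A s /\ forall u, V u -> ubound A u -> (s <= u)%O].

Definition inf_in d (P : porderType d) (V A : set P) : set P :=
  [set s | V s /\ lbound A s /\ forall u, V u -> lbound A u -> (u <= s)%O].

(* u_n ↑ l in V *)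
Definition increases_to d (P : porderType d) (V : set P) (u : nat -> P) (l : P) :=
  [/\ forall n, V (u n),
      forall m n, (m <= n)%N -> (u m <= u n)%O &
      sup_in V (range u) l].

Definition countably_dedekind_complete d (P : porderType d) :=
  forall a b : P, (a <= b)%O ->
  forall C : set P, C `<=` `[a, b]%classic -> countable C ->
    total_on C (fun x y => (x <= y)%O) ->
    (exists s, sup_in `[a, b]%classic C s) /\
    (exists i, inf_in `[a, b]%classic C i).

Definition order_continuous d (P : porderType d) (K : P -> P) :=
  forall (u : nat -> P) (l : P),
    increases_to setT u l -> increases_to setT (K \o u) (K l).

(* (V, {T_s : s in S}), where only the values of T_s on V matter. *)
Definition is_adp d (P : porderType d) (S : Type) (V : set P)
    (T : S -> P -> P) :=
  [/\ inhabited S,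
      forall s v, V v -> V (T s v) &
      forall s v w, V v -> V w -> (v <= w)%O -> (T s v <= T s w)%O].

Definition greedy d (P : porderType d) (S : Type) (T : S -> P -> P)
    (v : P) (s : S) :=
  forall t, (T t v <= T s v)%O.

(* Tv exists and equals w *)
Definition bellman_at d (P : porderType d) (S : Type) (V : set P)
    (T : S -> P -> P) (v w : P) :=
  sup_in V [set T s v | s in setT] w.

Definition solves_bellman d (P : porderType d) (S : Type) (V : set P)
    (T : S -> P -> P) (v : P) :=
  V v /\ bellman_at V T v v.

(* The default value v is only taken where the supremum does not exist. *)
Definition bellman d (P : porderType d) (S : Type) (V : set P)
    (T : S -> P -> P) (v : P) : P :=
  xget v [set w | bellman_at V T v w].

Definition fixpoints d (P : porderType d) (S : Type) (V : set P)
    (T : S -> P -> P) (s : S) : set P :=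
  [set v | V v /\ T s v = v].

Definition well_posed d (P : porderType d) (S : Type) (V : set P)
    (T : S -> P -> P) :=
  forall s, exists! v, fixpoints V T s v.

Definition regular d (P : porderType d) (S : Type) (V : set P)
    (T : S -> P -> P) :=
  forall v, V v -> exists s, greedy T v s.

(* V_Sigma; the definitions below that refer to it, or to the fixed point v_s,
   are meant for well-posed programs. *)
Definition policy_values d (P : porderType d) (S : Type) (V : set P)
    (T : S -> P -> P) : set P :=
  \bigcup_s fixpoints V T s.

Definition optimal d (P : porderType d) (S : Type) (V : set P)
    (T : S -> P -> P) (s : S) :=
  exists2 v, fixpoints V T s v & ubound (policy_values V T) v.

(* v^* exists and equals v *)
Definition is_value_function d (P : porderType d) (S : Type) (V : set P)
    (T : S -> P -> P) (v : P) :=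
  sup_in V (policy_values V T) v.

Definition bellman_principle d (P : porderType d) (S : Type) (V : set P)
    (T : S -> P -> P) :=
  well_posed V T /\
  [set s | optimal V T s] =
  [set s | exists2 vs, is_value_function V T vs & greedy T vs s].

Definition fundamental_optimality d (P : porderType d) (S : Type) (V : set P)
    (T : S -> P -> P) :=
  [/\ well_posed V T,
      regular V T,
      exists s, optimal V T s,
      exists2 vs, is_value_function V T vs &
        forall v, solves_bellman V T v <-> v = vs &
      bellman_principle V T].

(* A choice of a v-greedy policy for each v in V. *)
Definition greedy_selection d (P : porderType d) (S : Type) (V : set P)
    (T : S -> P -> P) (g : P -> S) :=
  forall v, V v -> greedy T v (g v).

(* v_{g v}; the default value v is only taken where there is no fixed point. *)
Definition howard d (P : porderType d) (S : Type) (V : set P)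
    (T : S -> P -> P) (g : P -> S) (v : P) : P :=
  xget v (fixpoints V T (g v)).

Definition optimistic d (P : porderType d) (S : Type) (T : S -> P -> P)
    (g : P -> S) (m : nat) (v : P) : P :=
  iter m (T (g v)) v.

(* V_U *)
Definition improvable d (P : porderType d) (S : Type) (V : set P)
    (T : S -> P -> P) : set P :=
  [set v | V v /\ exists2 w, bellman_at V T v w & (v <= w)%O].

Definition iterates_converge d (P : porderType d) (S : Type) (V : set P)
    (T : S -> P -> P) (F : P -> P) :=
  exists2 vs, is_value_function V T vs &
    forall v, improvable V T v -> increases_to V (fun n => iter n F v) vs.

Definition VFI_converges d (P : porderType d) (S : Type) (V : set P)
    (T : S -> P -> P) :=
  iterates_converge V T (bellman V T).

Definition OPI_converges d (P : porderType d) (S : Type) (V : set P)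
    (T : S -> P -> P) (g : P -> S) :=
  forall m, (0 < m)%N -> iterates_converge V T (optimistic T g m).

Definition HPI_converges d (P : porderType d) (S : Type) (V : set P)
    (T : S -> P -> P) (g : P -> S) :=
  iterates_converge V T (howard V T g).

(* Main.v *)
(* Put b = e / (1 - rho), so that V = [-b, b]; the bounds on r and K ensure
   that every T_s maps V to itself.  A difference d of two points of V with
   d <= K_s d satisfies d <= rho^n (2 b) for all n, hence d <= 0 since countable
   completeness makes E Archimedean; therefore v <= T_s v implies v <= v_s and
   T_s v <= v implies v_s <= v.  The iterates T^n (-b) increase to some vs in V,
   and order continuity of the T_s makes vs a fixed point of T.  A vs-greedy
   policy then has value vs, and T_t vs <= vs gives v_t <= vs for every t, so vs
   is the value function.  From an improvable v, each of the three algorithms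
   stays between T^n (-b) and vs, and hence also increases to vs. *)
Require Import Defs.
From HB Require Import structures.
From mathcomp Require Import all_boot all_order all_algebra.
From mathcomp Require Import boolp classical_sets functions cardinality.
From mathcomp Require Import set_interval reals.

Set Implicit Arguments.
Unset Strict Implicit.
Unset Printing Implicit Defensive.

Import Order.TTheory GRing.Theory Num.Theory.

Local Open Scope classical_set_scope.
Local Open Scope ring_scope.

(** * Bellman theory for order continuous policy operators on a poset with a least element and
    increasing limits *)

Section ContinuousPrograms.
Context d (P : porderType d) (S : Type) (V : set P) (T : S -> P -> P) (bot : P).
Local Open Scope order_scope.

Hypothesis adpT : is_adp V T.
Hypothesis regT : regular V T.
Hypothesis V_bot : V bot.
Hypothesis le_bot : forall v, V v -> bot <= v.
Hypothesis chain_complete : forall u : nat -> P,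
  (forall n, V (u n)) -> (forall n, u n <= u n.+1) ->
  exists l, increases_to V u l.
Hypothesis T_cont : forall s u l,
  increases_to V u l -> increases_to V (T s \o u) (T s l).
Hypothesis fix_ge : forall s v w,
  V v -> fixpoints V T s w -> v <= T s v -> v <= w.
Hypothesis fix_le : forall s v w,
  V v -> fixpoints V T s w -> T s v <= v -> w <= v.

Let T_V s v : V v -> V (T s v). Proof. by case: adpT => _ + _; exact. Qed.

Let T_mono s v w : V v -> V w -> v <= w -> T s v <= T s w.
Proof. by case: adpT => _ _; exact. Qed.

Let increases_toP u l : increases_to V u l ->
  [/\ forall n, V (u n), V l, forall n, u n <= l &
      forall w, V w -> (forall n, u n <= w) -> l <= w].
Proof.
case=> Vu _ [Vl [ubl leastl]]; split=> // [n|w Vw uw].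
  by apply: ubl; exists n.
by apply: leastl => // _ [n _ <-].
Qed.

Lemma increases_to_chain u l :
  (forall n, V (u n)) -> (forall n, u n <= u n.+1) -> V l ->
  (forall n, u n <= l) -> (forall w, V w -> (forall n, u n <= w) -> l <= w) ->
  increases_to V u l.
Proof.
move=> Vu incu Vl ul leastl; split=> // [m n|].
  by apply: (Order.NatMonotonyTheory.nondecnP incu).
split=> //; split=> [_ [n _ <-]//|w Vw uw].
by apply: leastl => // n; apply: uw; exists n.
Qed.

(** Kleene iteration of [T s] from [bot] yields a fixed point [l]; [fix_le] and [fix_ge], applied at
    [l], force every other fixed point to equal it. *)
Lemma continuous_well_posed : well_posed V T.
Proof.
move=> s; pose u n := iter n (T s) bot.
have Vu n : V (u n) by elim: n => [|n IHn] //=; exact: T_V.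
have incu n : u n <= u n.+1.
  elim: n => [|n IHn]; first exact/le_bot/T_V.
  exact: (T_mono s (Vu n) (Vu n.+1)).
have [l ul] := chain_complete Vu incu.
have [_ Vl le_l least_l] := increases_toP ul.
have [_ _ le_Tl least_Tl] := increases_toP (T_cont s ul).
have fixl : fixpoints V T s l.
  split=> //; apply: le_anti; rewrite least_Tl //=; last first.
    by move=> n; exact: (le_l n.+1).
  apply: least_l => [|n]; first exact: T_V.
  exact: le_trans (incu n) (le_Tl n).
exists l; split=> // w fixw; have Tl := proj2 fixl; apply: le_anti.
apply/andP; split; last by apply: (fix_le Vl fixw); rewrite Tl.
by apply: (fix_ge Vl fixw); rewrite Tl.
Qed.

(** A greedy value is a maximum over the policies, so the supremum exists and is attained. Under
    regularity the default value in [bellman] therefore never occurs on [V]. *)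
Lemma bellman_at_greedy v w s :
  V v -> greedy T v s -> bellman_at V T v w <-> w = T s v.
Proof.
move=> Vv gs; split=> [[Vw [ubw leastw]]|->].
  apply: le_anti; apply/andP; split; last by apply: ubw; exists s.
  by apply: leastw => [|_ [t _ <-]]; [exact: T_V | exact: gs].
split; first exact: T_V.
by split=> [_ [t _ <-]|u _ ubu]; [exact: gs | by apply: ubu; exists s].
Qed.

Lemma bellman_greedy v s : V v -> greedy T v s -> bellman V T v = T s v.
Proof.
move=> Vv gs; apply/(bellman_at_greedy _ Vv gs).
by apply: (xgetI v (x := T s v)); apply/(bellman_at_greedy _ Vv gs).
Qed.

(** Since a greedy policy attains the supremum, improvability becomes an inequality for one policy,
    the form that [fix_ge] accepts. *)
Lemma improvableP v : improvable V T v <-> V v /\ exists s, v <= T s v.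
Proof.
split=> [[Vv [w Tvw le_vw]]|[Vv [s le_v]]]; split=> //.
  have [s gs] := regT Vv; exists s.
  by rewrite -(proj1 (bellman_at_greedy w Vv gs) Tvw).
have [t gt] := regT Vv; exists (T t v); first exact/(bellman_at_greedy _ Vv gt).
exact: le_trans le_v (gt s).
Qed.

Lemma bellman_V v : V v -> V (bellman V T v).
Proof.
move=> Vv; have [s gs] := regT Vv.
by rewrite (bellman_greedy Vv gs); exact: T_V.
Qed.

Lemma le_bellman s v : V v -> T s v <= bellman V T v.
Proof.
by move=> Vv; have [t gt] := regT Vv; rewrite (bellman_greedy Vv gt).
Qed.

Lemma bellman_mono v w :
  V v -> V w -> v <= w -> bellman V T v <= bellman V T w.
Proof.
move=> Vv Vw le_vw; have [s gs] := regT Vv.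
by rewrite (bellman_greedy Vv gs) (le_trans (T_mono s Vv Vw le_vw)) ?le_bellman.
Qed.

Lemma vfi_bot_cvg : exists2 vs,
  increases_to V (fun n => iter n (bellman V T) bot) vs & bellman V T vs = vs.
Proof.
pose u n := iter n (bellman V T) bot.
have Vu n : V (u n) by elim: n => [|n IHn] //=; exact: bellman_V.
have incu n : u n <= u n.+1.
  elim: n => [|n IHn]; first exact/le_bot/bellman_V.
  exact: (bellman_mono (Vu n) (Vu n.+1)).
have [l ul] := chain_complete Vu incu; exists l => //.
have [_ Vl le_l least_l] := increases_toP ul.
(* At [l] the Bellman operator agrees with [T s] for one greedy [s], so continuity of that single
   operator suffices: [T s (u n) <= u n.+1 <= l]. *)
have [s gs] := regT Vl.
apply: le_anti; apply/andP; split.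
  rewrite (bellman_greedy Vl gs).
  have [_ _ _] := increases_toP (T_cont s ul); apply=> // n.
  exact: le_trans (le_bellman s (Vu n)) (le_l n.+1).
apply: least_l => [|n]; first exact: bellman_V.
exact: le_trans (incu n) (bellman_mono (Vu n) Vl (le_l n)).
Qed.

(** Here [T s v <= v] for every [s], so [fix_le] puts every policy value below [v]. *)
Lemma bellman_fix_value v : V v -> bellman V T v = v ->
  (forall s, greedy T v s -> fixpoints V T s v) /\ ubound (policy_values V T) v.
Proof.
move=> Vv Tv; split=> [s gs|w [s _ fw]].
  by split=> //; rewrite -(bellman_greedy Vv gs).
by apply: (fix_le Vv fw); rewrite -[leRHS]Tv le_bellman.
Qed.

Lemma bellman_fix_is_value v : V v -> bellman V T v = v ->
  is_value_function V T v.
Proof.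
move=> Vv Tv; have [fixv ubv] := bellman_fix_value Vv Tv.
split=> //; split=> // u _; apply; have [s gs] := regT Vv.
by exists s => //; exact: fixv.
Qed.

Lemma is_value_function_inj v w :
  is_value_function V T v -> is_value_function V T w -> v = w.
Proof.
move=> [Vv [ubv lv]] [Vw [ubw lw]].
by apply: le_anti; rewrite lv ?lw.
Qed.

Lemma continuous_fundamental_optimality : fundamental_optimality V T.
Proof.
have wp := continuous_well_posed.
have [vs /increases_toP[_ Vvs _ _] Tvs] := vfi_bot_cvg.
have [fixvs ubvs] := bellman_fix_value Vvs Tvs.
have val_vs := bellman_fix_is_value Vvs Tvs.
split=> //.
- by have [s gs] := regT Vvs; exists s; exists vs => //; exact: fixvs.
- exists vs => // v; split=> [[Vv bv]|->]; last first.
    split=> //; have [s gs] := regT Vvs.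
    by apply/(bellman_at_greedy _ Vvs gs); rewrite -(bellman_greedy Vvs gs).
  (* Any solution is itself the value function, so uniqueness of suprema gives uniqueness of
     solutions. *)
  apply: is_value_function_inj val_vs; apply: bellman_fix_is_value => //.
  have [s gs] := regT Vv.
  by rewrite (bellman_greedy Vv gs) -(proj1 (bellman_at_greedy _ Vv gs) bv).
split=> //; apply/seteqP; split=> s /=.
  move=> [v fv ubv]; exists vs => // t.
  (* A greatest policy value is the supremum [vs]; hence [T s vs = vs] is the Bellman value at [vs],
     which dominates every [T t vs]. *)
  have v_vs : v = vs.
    apply: is_value_function_inj val_vs; split; first by case: fv.
    by split=> // u _; apply; exists s.
  rewrite v_vs in fv.
  by rewrite (proj2 fv) -[leRHS]Tvs le_bellman.
move=> [v /is_value_function_inj/(_ val_vs) -> gs].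
by exists vs => //; exact: fixvs.
Qed.

(* Such an F is squeezed between value iteration from the bottom and v^*. *)
Lemma iterates_converge_ge_bellman (F : P -> P) :
  (forall v, improvable V T v -> improvable V T (F v) /\ bellman V T v <= F v) ->
  iterates_converge V T F.
Proof.
move=> stepF; have [vs uvs Tvs] := vfi_bot_cvg.
have [Vu Vvs le_vs least_vs] := increases_toP uvs.
exists vs => [|v Uv]; first exact: bellman_fix_is_value.
have UF n : improvable V T (iter n F v).
  by elim: n => //= n /stepF[].
have VF n : V (iter n F v) by case: (UF n).
have le_F n : bellman V T (iter n F v) <= iter n.+1 F v.
  by have [] := stepF _ (UF n).
apply: increases_to_chain => // [n|n|w Vw le_w].
- have /improvableP[_ [s le_s]] := UF n.
  by rewrite (le_trans le_s) // (le_trans (le_bellman s (VF n))).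
- have /improvableP[_ [s le_s]] := UF n.
  (* The value [z] of an improving policy lies above the iterate and below [vs]. *)
  have [z [fz _]] := continuous_well_posed s.
  have [_ ubvs] := bellman_fix_value Vvs Tvs.
  by rewrite (le_trans (fix_ge (VF n) fz le_s)) ?ubvs //; exists s.
- apply: least_vs => // n; apply: le_trans (le_w n).
  elim: n => [|n IHn] /=; first exact/le_bot/(VF 0%N).
  by rewrite (le_trans (bellman_mono (Vu n) (VF n) IHn)).
Qed.

Lemma continuous_VFI : VFI_converges V T.
Proof.
apply: iterates_converge_ge_bellman => v /improvableP[Vv [s le_v]].
split=> //; apply/improvableP; have VTv := bellman_V Vv; split=> //.
(* A [v]-greedy [t] also improves the next iterate, which is [T t v], by monotonicity of [T t]. *)
have [t gt] := regT Vv; exists t; rewrite {1}(bellman_greedy Vv gt).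
by apply: T_mono => //; rewrite (le_trans le_v) ?le_bellman.
Qed.

(** From [v <= T s v] the iterates of [T s] increase; so the result is still improved by [s] and
    lies above the first iterate, the Bellman value. *)
Lemma continuous_OPI g : greedy_selection V T g -> OPI_converges V T g.
Proof.
move=> selg [//|m] _.
apply: iterates_converge_ge_bellman => v /improvableP[Vv [t le_tv]].
rewrite (bellman_greedy Vv (selg v Vv)) /optimistic; set s := g v.
have le_v : v <= T s v := le_trans le_tv (selg v Vv t).
have Vi n : V (iter n (T s) v) by elim: n => //= n; exact: T_V.
have inci n : iter n (T s) v <= iter n.+1 (T s) v.
  by elim: n => //= n IHn; exact: (T_mono s (Vi n) (Vi n.+1)).
split; first by apply/improvableP; split=> //; exists s; exact: inci.
by elim: m => [|m IHm]; [exact: lexx | exact: le_trans IHm (inci m.+1)].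
Qed.

(** The new point is fixed by [T (g v)], hence improvable; [fix_ge], applied to [T (g v) v], puts it
    above the Bellman value. *)
Lemma continuous_HPI g : greedy_selection V T g -> HPI_converges V T g.
Proof.
move=> selg.
apply: iterates_converge_ge_bellman => v /improvableP[Vv [t le_tv]].
have le_v : v <= T (g v) v := le_trans le_tv (selg v Vv t).
rewrite (bellman_greedy Vv (selg v Vv)) /howard.
have [z [fz _]] := continuous_well_posed (g v).
have fH := xgetI v fz.
set h := xget _ _ in fH *.
have [Vh Th] := fH; split.
  by apply/improvableP; split=> //; exists (g v); rewrite Th.
by apply: (fix_ge _ fH); [exact: T_V | apply: T_mono => //; exact: T_V].
Qed.

End ContinuousPrograms.

(** * Riesz spaces: order arithmetic, monotone limits and geometric domination *)

Section RieszOrder.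
Context (R : realType) (E : rieszType R).
Implicit Types (x y z : E) (a : R).

Lemma riesz_lerD x y z t : x <= y -> z <= t -> x + z <= y + t.
Proof.
move=> le_xy le_zt; apply: (le_trans (riesz_lerD2r z _ _ le_xy)).
by rewrite ![y + _]addrC; exact: riesz_lerD2r.
Qed.

Lemma riesz_subr_ge0 x y : (0 <= y - x) = (x <= y).
Proof.
apply/idP/idP => [/(riesz_lerD2r x)|/(riesz_lerD2r (- x))].
  by rewrite add0r subrK.
by rewrite subrr.
Qed.

Lemma riesz_lerN2 x y : (- x <= - y) = (y <= x).
Proof. by rewrite -(riesz_subr_ge0 (- x)) opprK addrC riesz_subr_ge0. Qed.

Lemma riesz_subr_le0 x y : (x - y <= 0) = (x <= y).
Proof. by rewrite -(riesz_lerN2 0) oppr0 opprB riesz_subr_ge0. Qed.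

Lemma riesz_ler_wpZ2l a x y : 0 <= a -> x <= y -> a *: x <= a *: y.
Proof.
rewrite -(riesz_subr_ge0 x) -(riesz_subr_ge0 (a *: x)) -scalerBr.
exact: riesz_scaler_ge0.
Qed.

(** The meet with [b] moves an arbitrary upper bound into the interval; a point of [A] keeps that
    meet above [a]. *)
Lemma sup_in_itv_setT (a b s : E) (A : set E) :
  A `<=` `[a, b] -> A !=set0 -> sup_in `[a, b] A s -> sup_in setT A s.
Proof.
move=> Aab [x0 Ax0] [sab [ubs leasts]]; split=> //; split=> // u _ ubu.
have : s <= riesz_meet u b; last by rewrite riesz_lexI => /andP[].
have ubm : ubound A (riesz_meet u b).
  move=> x Ax; rewrite riesz_lexI ubu //=.
  by have := Aab _ Ax; rewrite /= in_itv /= => /andP[].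
apply: leasts => //=; rewrite in_itv /= (le_trans _ (ubm _ Ax0)) /=.
  by have := lexx (riesz_meet u b); rewrite riesz_lexI => /andP[].
by have := Aab _ Ax0; rewrite /= in_itv /= => /andP[].
Qed.

Lemma increases_to_setT (a b l : E) (u : nat -> E) :
  increases_to `[a, b] u l -> increases_to setT u l.
Proof.
move=> [uab incu supl]; split=> //; apply: sup_in_itv_setT supl.
  by move=> _ [n _ <-].
by exists (u 0%N), 0%N.
Qed.

Lemma increases_to_sub (V : set E) (u : nat -> E) l : (forall n, V (u n)) ->
  V l -> increases_to setT u l -> increases_to V u l.
Proof.
move=> Vu Vl [_ incu [_ [ubl leastl]]]; split=> //.
by split=> //; split=> // w _; exact: leastl.
Qed.

Lemma increases_toDl (c l : E) (u : nat -> E) :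
  increases_to setT u l -> increases_to setT (fun n => c + u n) (c + l).
Proof.
move=> [_ incu [_ [ubl leastl]]]; split=> // [m n le_mn|].
  by apply: riesz_lerD => //; exact: incu.
split=> //; split=> [_ [n _ <-]|w _ ubw].
  by apply: riesz_lerD => //; apply: ubl; exists n.
suff /(riesz_lerD (lexx c)) : l <= w - c by rewrite addrCA subrr addr0.
apply: leastl => // _ [n _ <-].
have /(riesz_lerD (lexx (- c))) : c + u n <= w by apply: ubw; exists n.
by rewrite addrA addNr add0r addrC.
Qed.

Lemma increasing_cvg (a b : E) (u : nat -> E) :
  countably_dedekind_complete E ->
  (forall n, `[a, b]%classic (u n)) -> (forall n, u n <= u n.+1) ->
  exists l, increases_to `[a, b] u l.
Proof.
move=> cdc uab incu; have mono : {homo u : m n / (m <= n)%N >-> m <= n}.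
  exact: Order.NatMonotonyTheory.nondecnP.
have le_ab : a <= b.
  by have := uab 0%N; rewrite /= in_itv /= => /andP[]; exact: le_trans.
have [] := cdc a b le_ab (range u).
- by move=> _ [n _ <-].
- exact: card_image_le.
- move=> _ _ [m _ <-] [n _ <-].
  by case/orP: (leq_total m n) => /mono; [left | right].
by move=> [l supl] _; exists l.
Qed.

(* The infimum i of the chain (rho^n c) satisfies rho^-1 i <= i. *)
Lemma le0_geometric (x c : E) (rho : R) : countably_dedekind_complete E ->
  0 <= rho < 1 -> 0 <= c -> (forall n, x <= rho ^+ n *: c) -> x <= 0.
Proof.
move=> cdc /andP[rho0 rho1] c0 le_x.
(* The shift argument divides by [rho]; for [rho = 0] the bound at [n = 1] suffices. *)
have [rho_eq0|rho_neq0] := eqVneq rho 0.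
  by have := le_x 1%N; rewrite rho_eq0 expr1 scale0r.
have rho_gt0 : 0 < rho by rewrite lt_neqAle eq_sym rho_neq0.
pose u n := rho ^+ n *: c.
have u_ge0 n : 0 <= u n by apply: riesz_scaler_ge0 => //; exact: exprn_ge0.
have decu m n : (m <= n)%N -> u n <= u m.
  move=> le_mn; rewrite -riesz_subr_ge0 -scalerBl.
  apply: riesz_scaler_ge0 => //.
  by rewrite subr_ge0 ler_wiXn2l // ltW.
have u_le n : u n <= c by have := decu 0%N n isT; rewrite {2}/u expr0 scale1r.
have [|||_ [i [i0c [lbi infi]]]] := cdc 0 c c0 (range u).
- by move=> _ [n _ <-]; rewrite /= in_itv /= u_ge0 u_le.
- exact: card_image_le.
- move=> _ _ [m _ <-] [n _ <-].
  by case/orP: (leq_total m n) => /decu; [right | left].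
have i_le n : i <= u n by apply: lbi; exists n.
have i_ge0 : 0 <= i by move: i0c; rewrite /= in_itv /= => /andP[].
have le_i y : 0 <= y -> (forall n, y <= u n) -> y <= i.
  move=> y0 le_y; apply: infi => [|_ [n _ <-]//].
  by rewrite /= in_itv /= y0 (le_trans (le_y 0%N)).
have rhoV_i : rho^-1 *: i <= i.
  apply: le_i => [|n]; first by apply: riesz_scaler_ge0; rewrite ?invr_ge0.
  have -> : u n = rho^-1 *: u n.+1 by rewrite scalerA exprS mulKf.
  by apply: riesz_ler_wpZ2l; rewrite ?invr_ge0.
have i_le0 : i <= 0.
  have rhoV_gt1 : 0 < rho^-1 - 1 by rewrite subr_gt0 invf_gt1.
  rewrite -[i](scalerK (lt0r_neq0 rhoV_gt1)) -[leRHS](scaler0 _ (rho^-1 - 1)^-1).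
  apply: riesz_ler_wpZ2l; first by rewrite invr_ge0 ltW.
  by rewrite scalerBl scale1r riesz_subr_le0.
(* As [x] may lie outside [[0, c]], the join of [x] and [0] is compared with [i] instead. *)
have := lexx (riesz_join x 0); rewrite {1}riesz_leUx => /andP[le_xy y_ge0].
rewrite (le_trans le_xy) // (le_trans _ i_le0) // le_i // => n.
by rewrite riesz_leUx le_x u_ge0.
Qed.

(** Inductively, [x <= K x <= rho ^+ n *: K c <= rho ^+ n.+1 *: c]. *)
Lemma le0_subharmonic (K : {linear E -> E}) (c x : E) (rho : R) :
  countably_dedekind_complete E -> {homo K : y z / y <= z} ->
  0 <= rho < 1 -> 0 <= c -> K c <= rho *: c -> x <= c -> x <= K x -> x <= 0.
Proof.
move=> cdc Kmono rho01 c0 Kc le_xc le_xK.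
apply: (le0_geometric cdc rho01 c0) => n.
elim: n => [|n IHn]; first by rewrite expr0 scale1r.
apply: (le_trans le_xK); apply: (le_trans (Kmono _ _ IHn)).
rewrite linearZ exprSr -scalerA; apply: riesz_ler_wpZ2l => //.
by apply: exprn_ge0; case/andP: rho01.
Qed.

End RieszOrder.

(** * Affine programs on the interval [[- b, b]] *)

Section AffinePrograms.
Context (R : realType) (E : rieszType R) (Sigma : Type).
Context (T : Sigma -> E -> E) (r : Sigma -> E) (K : Sigma -> {linear E -> E}).
Context (b : E) (rho : R).
Let V : set E := `[- b, b]%classic.

Hypothesis cdc : countably_dedekind_complete E.
Hypothesis adpT : is_adp setT T.
Hypothesis K_cont : forall s, order_continuous (K s).
Hypothesis T_affine : forall s v, T s v = r s + K s v.
Hypothesis rho01 : 0 <= rho < 1.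
Hypothesis b_ge0 : 0 <= b.
Hypothesis r_le : forall s, r s <= b - rho *: b.
Hypothesis Nr_le : forall s, - r s <= b - rho *: b.
Hypothesis Kb_le : forall s, K s b <= rho *: b.

Let in_V v : V v <-> - b <= v /\ v <= b.
Proof. by rewrite /V /= in_itv /=; split=> [/andP|[-> ->]]. Qed.

(** Positivity of [K s] is inherited from [T s] by cancelling [r s]. *)
Lemma affine_K_mono s : {homo K s : v w / v <= w}.
Proof.
case: adpT => _ _ T_mono v w /(T_mono s v w I I).
rewrite !T_affine => /(riesz_lerD (lexx (- r s))).
by rewrite !addrA addNr !add0r.
Qed.

(** In [b = (b - rho *: b) + rho *: b] the first summand bounds [r s] and its opposite, the second
    [K s v] and its opposite. *)
Lemma affine_adp : is_adp V T.
Proof.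
case: adpT => inhS _ T_mono; split=> // [s v /in_V[ge_v le_v]|s v w _ _].
  apply/in_V; rewrite T_affine; split.
    rewrite -riesz_lerN2 opprK opprD -[leRHS](subrK (rho *: b)).
    apply: riesz_lerD => //; apply: le_trans (Kb_le s).
    by rewrite -linearN; apply: affine_K_mono; rewrite -riesz_lerN2 opprK.
  rewrite -[leRHS](subrK (rho *: b)); apply: riesz_lerD => //.
  exact: le_trans (affine_K_mono s le_v) (Kb_le s).
exact: T_mono.
Qed.

(** Order continuity of [K s] concerns suprema in [E], so the limit is carried from [V] to [E] and
    back. *)
Lemma affine_continuous s u l :
  increases_to V u l -> increases_to V (T s \o u) (T s l).
Proof.
move=> ul; have [Vu _ [Vl _]] := ul; have [_ T_V _] := affine_adp.
apply: increases_to_sub => [n||]; [exact: T_V | exact: T_V |].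
have -> : T s \o u = fun n => r s + (K s \o u) n.
  by apply/funext => n /=; rewrite T_affine.
by rewrite T_affine; apply/increases_toDl/K_cont; exact: increases_to_setT ul.
Qed.

(** Two points of [V] differ by at most [b + b], the constant fed to [le0_subharmonic]. *)
Let b2_ge0 : 0 <= b + b.
Proof. by have := riesz_lerD b_ge0 b_ge0; rewrite addr0. Qed.

Let Kb2_le s : K s (b + b) <= rho *: (b + b).
Proof. by rewrite linearD scalerDr; exact: riesz_lerD. Qed.

(** The term [r s] cancels in differences: [K s (v - w) = T s v - w >= v - w]. *)
Lemma affine_fix_ge s v w :
  V v -> fixpoints V T s w -> v <= T s v -> v <= w.
Proof.
move=> /in_V[_ le_vb] [/in_V[ge_wb _] Tw] le_v; rewrite -riesz_subr_le0.
apply: (le0_subharmonic cdc (affine_K_mono s) rho01 b2_ge0 (Kb2_le s)).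
  by apply: riesz_lerD => //; rewrite -riesz_lerN2 opprK.
have -> : K s (v - w) = T s v - T s w.
  by rewrite linearB !T_affine opprD addrACA subrr add0r.
by rewrite Tw; exact: riesz_lerD.
Qed.

Lemma affine_fix_le s v w :
  V v -> fixpoints V T s w -> T s v <= v -> w <= v.
Proof.
move=> /in_V[ge_vb _] [/in_V[_ le_wb] Tw] le_v; rewrite -riesz_subr_le0.
apply: (le0_subharmonic cdc (affine_K_mono s) rho01 b2_ge0 (Kb2_le s)).
  by apply: riesz_lerD => //; rewrite -riesz_lerN2 opprK.
have -> : K s (w - v) = T s w - T s v.
  by rewrite linearB !T_affine opprD addrACA subrr add0r.
by rewrite Tw; apply: riesz_lerD => //; rewrite riesz_lerN2.
Qed.

Lemma itv_bottom : V (- b) /\ forall v, V v -> - b <= v.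
Proof.
split=> [|v /in_V[]//]; apply/in_V; split=> //.
by apply: le_trans b_ge0; rewrite -riesz_lerN2 oppr0 opprK.
Qed.

End AffinePrograms.

Theorem theorem5p4 (R : realType) (E : rieszType R) (Sigma : Type)
    (T : Sigma -> E -> E) (r : Sigma -> E) (K : Sigma -> {linear E -> E})
    (e : E) (rho : R) :
  countably_dedekind_complete E ->
  is_adp setT T ->
  regular setT T ->
  (forall s, order_continuous (K s)) ->
  (forall s v, T s v = r s + K s v) ->
  0 <= rho < 1 ->
  (forall s, riesz_abs (r s) <= e) ->
  (forall s, K s e <= rho *: e) ->
  let V : set E :=
    `[- ((1 - rho)^-1 *: e), (1 - rho)^-1 *: e]%classic in
  [/\ is_adp V T,
      fundamental_optimality V T &
      VFI_converges V T /\
      (forall g : E -> Sigma, greedy_selection V T g ->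
        OPI_converges V T g /\ HPI_converges V T g)].
Proof.
move=> cdc adpT regT K_cont T_affine rho01 r_le Ke_le V.
have rho1_gt0 : 0 < 1 - rho by rewrite subr_gt0; case/andP: rho01.
have rho1V_ge0 : 0 <= (1 - rho)^-1 by rewrite invr_ge0 ltW.
(* Some policy [s] exists; adding the bounds on [r s] and [- r s] gives [0 <= e + e], which is then
   halved. *)
have e_ge0 : 0 <= e.
  have [[s] _ _] := adpT; have := r_le s.
  rewrite riesz_leUx => /andP[re Nre]; have := riesz_lerD re Nre.
  have half_ge0 : 0 <= 2^-1 :> R by rewrite invr_ge0.
  rewrite subrr => /(riesz_ler_wpZ2l half_ge0).
  by rewrite scaler0 -mulr2n -scaler_nat scalerA mulVf ?scale1r ?pnatr_eq0.
pose b := (1 - rho)^-1 *: e.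
have b_ge0 : 0 <= b by exact: riesz_scaler_ge0.
have b_e : b - rho *: b = e.
  by rewrite -{1}[b]scale1r -scalerBl scalerA divff ?scale1r ?gt_eqF.
have r_le_b s : r s <= b - rho *: b.
  by have := r_le s; rewrite riesz_leUx b_e => /andP[].
have Nr_le_b s : - r s <= b - rho *: b.
  by have := r_le s; rewrite riesz_leUx b_e => /andP[].
have Kb_le s : K s b <= rho *: b.
  rewrite /b linearZ [leRHS]scalerA mulrC -scalerA.
  exact: (riesz_ler_wpZ2l rho1V_ge0 (Ke_le s)).
have adpV : is_adp V T := affine_adp adpT T_affine r_le_b Nr_le_b Kb_le.
(* Greediness compares the values at one point only, so it does not depend on the ambient set. *)
have regV : regular V T by move=> v _; exact: regT.
have [Vbot le_bot] := itv_bottom b_ge0.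
have chain := fun u => @increasing_cvg R E (- b) b u cdc.
have contV := affine_continuous adpT K_cont T_affine r_le_b Nr_le_b Kb_le.
have ge_fix := affine_fix_ge cdc adpT T_affine rho01 b_ge0 Kb_le.
have le_fix := affine_fix_le cdc adpT T_affine rho01 b_ge0 Kb_le.
split=> //.
  exact: (continuous_fundamental_optimality adpV regV Vbot le_bot chain contV
    ge_fix le_fix).
split=> [|g selg].
  exact: (continuous_VFI adpV regV Vbot le_bot chain contV
    ge_fix le_fix).
split.
  exact: (continuous_OPI adpV regV Vbot le_bot chain contV
    ge_fix le_fix selg).
exact: (continuous_HPI adpV regV Vbot le_bot chain contV
  ge_fix le_fix selg).
Qed.
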